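(* Let $n$ be a positive integer, let $p$ be a prime, and let $A_1,\dots,A_n$ and $B_1,\dots,B_n$ be finite non-empty subsets of $\mathbb{Z}_p$. Let $A'_1,\dots,A'_n$ and $B'_1,\dots,B'_n$ be intervals in $\mathbb{Z}_p$ with $|A'_i|=|A_i|$ and $|B'_i|=|B_i|$ for all $i$, such that each $A'_i+B'_i$ is centred at $0$ or $1/2$ (depending on parity); in the case when $A'_i+B'_i=\mathbb{Z}_p$ this means that the sum of the centres of $A'_i$ and $B'_i$ is $0$ or $1/2$. Let $b_1,\dots,b_n$ be chosen independently with $b_i$ uniform in $B_i$, and let $b'_1,\dots,b'_n$ be chosen independently with $b'_i$ uniform in $B'_i$. Then $$\mathbb{E}\Big(\Big|\bigcup_{i=1}^n(A_i+b_i)\Big|\Big)\ \ge\ \mathbb{E}\Big(\Big|\bigcup_{i=1}^n(A'_i+b'_i)\Big|\Big).$$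
   Context: $\mathbb{Z}_p=\mathbb{Z}/p\mathbb{Z}$ is the cyclic group of order $p$, and $|\cdot|$ denotes cardinality. An interval in $\mathbb{Z}_p$ is a set of the form $\{a,a+1,\dots,a+k-1\}$ with $1\le k\le p$; for $k<p$ its centre is $a+\frac{k-1}{2}$, regarded as an integer or half-integer modulo $p$ (an element of $\frac12\mathbb{Z}/p\mathbb{Z}$). The whole group $\mathbb{Z}_p$ is also allowed as an interval, and is considered to be centred at any point one chooses. When $A'_i+B'_i\neq\mathbb{Z}_p$, it is an interval of size $|A_i|+|B_i|-1$, whose centre is the sum of the centres of $A'_i$ and $B'_i$; the centre is $0$ when $|A_i|+|B_i|$ is even and $1/2$ when $|A_i|+|B_i|$ is odd. *)

(* Defs.v *)
From mathcomp Require Import all_boot all_order all_algebra.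
Set Implicit Arguments.
Unset Strict Implicit.
Unset Printing Implicit Defensive.
Import GRing.Theory.
Local Open Scope ring_scope.

(* {a, a+1, ..., a+k-1}. *)
Definition Zp_itv (p : nat) (a : 'Z_p) (k : nat) : {set 'Z_p} :=
  [set a + (nat_of_ord i)%:R | i : 'I_k].

Definition is_itv (p : nat) (A : {set 'Z_p}) : Prop :=
  exists (a : 'Z_p) (k : nat), (1 <= k <= p)%N /\ A = Zp_itv a k.

(* Doubling identifies (1/2)Z/pZ, where centres of intervals live, with Z/2pZ.
   [half_pt p m] is the point m/2, encoded as the class of m modulo 2p. *)
Definition half_pt (p m : nat) : 'Z_(2 * p) := m%:R.

(* The centre a + (k-1)/2 is the half-point of 2a + (k-1); replacing the
   representative of a in {0, ..., p-1} by another one does not change its class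
   modulo 2p. The whole group is centred at every point. *)
Definition centred_at (p : nat) (A : {set 'Z_p}) (c : 'Z_(2 * p)) : Prop :=
  A = [set: 'Z_p] \/
  exists (a : 'Z_p) (k : nat),
    [/\ (1 <= k < p)%N, A = Zp_itv a k
      & c = half_pt p (2 * nat_of_ord a + (k - 1))].

Definition sumset (p : nat) (A B : {set 'Z_p}) : {set 'Z_p} :=
  [set x + y | x in A, y in B].

Definition translate (p : nat) (A : {set 'Z_p}) (b : 'Z_p) : {set 'Z_p} :=
  [set x + b | x in A].

(* The target centre is 0 or 1/2 according to the parity of |A| + |B|. *)
Definition sum_centred (p : nat) (A B : {set 'Z_p}) : Prop :=
  let c := half_pt p (odd (#|A| + #|B|)) in
  if sumset A B != [set: 'Z_p] then centred_at (sumset A B) c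
  else exists cA cB : 'Z_(2 * p),
    [/\ centred_at A cA, centred_at B cB & cA + cB = c].

Definition unif (T : finType) (B : {set T}) (x : T) : rat :=
  if x \in B then #|B|%:R^-1 else 0.

(* Expectation of f (b_1, ..., b_n) for independent b_i, each uniform in B_i:
   the joint law of the b_i is the product of the uniform laws. *)
Definition expect_unif (n : nat) (T : finType) (B : 'I_n -> {set T})
    (f : {ffun 'I_n -> T} -> rat) : rat :=
  \sum_(b : {ffun 'I_n -> T}) (\prod_(i < n) unif (B i) (b i)) * f b.

Definition expected_union (n p : nat) (A B : 'I_n -> {set 'Z_p}) : rat :=
  expect_unif B (fun b => #|\bigcup_(i < n) translate (A i) (b i)|%:R).

(* Main.v *)
(** Let [rep A B x] be the number of [y] in [B] with [x - y] in [A]. A point [x]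
    is missed by all the [A_i + b_i] with probability [prod_i (1 - rep A_i B_i x / |B_i|)],
    so one has to bound [sum_x prod_i (|B_i| - rep A_i B_i x)] from above by the
    same quantity for the intervals. Writing each factor as the number of
    [t < |B_i|] with [rep A_i B_i x <= t] turns this sum into a sum of cardinals of
    intersections of sublevel sets, each at most the minimum of the cardinals of the
    sets involved. For the intervals the superlevel sets of [rep] all belong to the
    chain {0}, {0, 1}, {-1, 0, 1}, ..., so that this is an equality. The sublevel
    cardinals can then be exchanged for those of the intervals one index [i] at a
    time, which only requires
    [sum_x min(t, rep A'_i B'_i x) <= sum_x min(t, rep A_i B_i x)] for [t <= |B_i|]:
    this is Pollard's theorem, proved with the Dyson e-transform. *)

Require Import Defs.
From mathcomp Require Import all_boot all_order all_algebra.
From mathcomp Require Import zify ring.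
Set Implicit Arguments.
Unset Strict Implicit.
Unset Printing Implicit Defensive.
Import GRing.Theory.
Local Open Scope ring_scope.

(** * Layer cake sums *)

Section LayerCake.
Local Open Scope nat_scope.
Variables (I T : finType) (b : I -> nat).
Implicit Types (u v : I -> nat -> nat) (l : seq I) (c d : nat).

(* With u i t the cardinal of the t-th layer of index i, this is the sum over all
   families (t_i) with t_i < b i of the minimum of c and the u i (t_i). *)
Fixpoint layers u l c : nat :=
  if l is i :: l' then \sum_(t < b i) layers u l' (minn c (u i t)) else c.

Lemma leq_layers u l c d : c <= d -> layers u l c <= layers u l d.
Proof.
elim: l c d => [|i l IHl] c d //= le_cd.
by apply: leq_sum => t _; apply: IHl; rewrite geq_min !leq_min; lia.
Qed.

(** Successive caps commute, so the cap by [f t] can be applied last; the induction then runs with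
    [c] replaced by [minn c (u i s)]. *)
Lemma sum_layers_le u l k (f g : nat -> nat) :
  (forall c, \sum_(t < k) minn c (f t) <= \sum_(t < k) minn c (g t)) ->
  forall c, \sum_(t < k) layers u l (minn c (f t)) <=
            \sum_(t < k) layers u l (minn c (g t)).
Proof.
move=> le_fg; elim: l => [|i l IHl] c //=.
rewrite exchange_big [leqRHS]exchange_big /=.
apply: leq_sum => s _.
under eq_bigr do rewrite minnAC.
under [leqRHS]eq_bigr do rewrite minnAC.
exact: IHl.
Qed.

(** The tail is exchanged by induction, the head index by [sum_layers_le]. *)
Lemma layers_le u v l :
  (forall i c, \sum_(t < b i) minn c (u i t) <= \sum_(t < b i) minn c (v i t)) ->
  forall c, layers u l c <= layers v l c.
Proof.
move=> le_uv; elim: l => [|i l IHl] c //=.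
apply: leq_trans (sum_layers_le v l (le_uv i) c).
by apply: leq_sum => t _; apply: IHl.
Qed.

Lemma sum_leq_ord k r : \sum_(t < k) (r <= t) = k - r.
Proof.
elim: k => [|k IHk]; first by rewrite big_ord0.
by rewrite big_ord_recr /= IHk; lia.
Qed.

Variable r : I -> T -> nat.

Let sublevel i (t : nat) : {set T} := [set x | r i x <= t].

(** The factor [b i - r i x] counts the [t < b i] with [r i x <= t]; moving the sum over [t] outside
    restricts [x] to a sublevel set. *)
Lemma sum_prod_cons i l (S : {set T}) :
  \sum_(x in S) \prod_(j <- i :: l) (b j - r j x) =
  \sum_(t < b i) \sum_(x in S :&: sublevel i t) \prod_(j <- l) (b j - r j x).
Proof.
under eq_bigr => x _ do rewrite big_cons -sum_leq_ord big_distrl.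
rewrite exchange_big; apply: eq_bigr => t _ /=.
rewrite [RHS](eq_bigl (fun x => (x \in S) && (x \in sublevel i t))) => [|x]; last exact: in_setI.
by rewrite [RHS]big_mkcondr; apply: eq_bigr => x _; rewrite inE; case: leqP; lia.
Qed.

Lemma sum_prod_le_layers l (S : {set T}) :
  \sum_(x in S) \prod_(j <- l) (b j - r j x) <=
  layers (fun i t => #|sublevel i t|) l #|S|.
Proof.
elim: l S => [|i l IHl] S.
  by under eq_bigr do rewrite big_nil; rewrite sum1_card.
rewrite sum_prod_cons; apply: leq_sum => t _.
apply: leq_trans (IHl _) _; apply: leq_layers.
by rewrite leq_min !subset_leq_card ?subsetIl ?subsetIr.
Qed.

(** In a chain the intersection of two members is the smaller one: it stays in [C] and its cardinal
    is exactly the minimum. *)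
Lemma sum_prod_eq_layers (C : {set T} -> Prop) l (S : {set T}) :
  (forall X Y, C X -> C Y -> X \subset Y \/ Y \subset X) ->
  (forall i t, C (sublevel i t)) -> C S ->
  \sum_(x in S) \prod_(j <- l) (b j - r j x) =
  layers (fun i t => #|sublevel i t|) l #|S|.
Proof.
move=> chainC C_sub; elim: l S => [|i l IHl] S CS.
  by under eq_bigr do rewrite big_nil; rewrite sum1_card.
rewrite sum_prod_cons; apply: eq_bigr => t _ /=.
have [sub|sub] := chainC _ _ CS (C_sub i t); have:= subset_leq_card sub.
  by move=> /minn_idPl ->; rewrite (setIidPl sub) IHl.
by move=> /minn_idPr ->; rewrite (setIidPr sub) IHl.
Qed.

End LayerCake.

(** Induction on [k]: if the last value of [g] is at least [c], the last right-hand term is [c] and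
    dominates its counterpart; otherwise monotonicity leaves every [g t] uncut and the uncapped sums
    suffice. *)
Lemma sum_min_le k (f g : nat -> nat) (c : nat) : {homo g : s t / (s <= t)%N} ->
  (forall j, j <= k -> \sum_(t < j) f t <= \sum_(t < j) g t)%N ->
  (\sum_(t < k) minn c (f t) <= \sum_(t < k) minn c (g t))%N.
Proof.
move=> g_mono; elim: k => [|k IHk] le_fg; first by rewrite !big_ord0.
have [le_cg|lt_gc] := leqP c (g k).
  rewrite !big_ord_recr /= leq_add ?IHk //; last by move: le_cg; lia.
  by move=> j le_jk; apply: le_fg; apply: leqW.
have -> : (\sum_(t < k.+1) minn c (g t) = \sum_(t < k.+1) g t)%N.
  apply: eq_bigr => t _; apply/minn_idPr.
  by apply: leq_trans (ltnW lt_gc); apply: g_mono; rewrite -ltnS.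
by apply: leq_trans (le_fg _ (leqnn _)); apply: leq_sum => t _; apply: geq_minr.
Qed.

Lemma sum_minn_card (T : finType) (f : T -> nat) t :
  (\sum_x minn t (f x) = \sum_(s < t) #|[set x | s < f x]|)%N.
Proof.
under [RHS]eq_bigr do rewrite -sum1dep_card big_mkcond /=.
rewrite exchange_big /=; apply: eq_bigr => x _.
elim: t => [|t IHt]; first by rewrite big_ord0 min0n.
by rewrite big_ord_recr /= -IHt; case: ifP; lia.
Qed.

(** * Pollard's theorem *)

Section RepCount.
Variable G : finZmodType.
Implicit Types (A B C : {set G}) (x y : G).

Definition rep A B x : nat := (\sum_(y in B) ((x - y)%R \in A))%N.

Lemma rep_le A B x : (rep A B x <= #|B|)%N.
Proof. by rewrite -sum1_card; apply: leq_sum => y _; apply: leq_b1. Qed.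

Lemma rep_sym A B x : rep A B x = rep B A x.
Proof.
rewrite /rep big_mkcond [RHS]big_mkcond (reindex_inj (inv_inj (subKr x))) /=.
by apply: eq_bigr => y _; rewrite subKr; do 2!case: (_ \in _).
Qed.

Lemma sum_rep A B : (\sum_x rep A B x = #|A| * #|B|)%N.
Proof.
rewrite exchange_big /= mulnC -sum_nat_const; apply: eq_bigr => y _.
rewrite (reindex_inj (addIr y)) /=; under eq_bigr do rewrite addrK.
by rewrite -big_mkcond sum1_card.
Qed.

Lemma rep_shift A B e x : rep A [set y + e | y in B] x = rep A B (x - e).
Proof.
rewrite /rep big_imset /=; last by move=> y z _ _; apply: addIr.
by apply: eq_bigr => y _; rewrite opprD addrA addrAC.
Qed.

Lemma rep_setID A B C x : rep A B x = (rep A (B :&: C) x + rep A (B :\: C) x)%N.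
Proof. by rewrite /rep (big_setID C). Qed.

(* Dyson's e-transform. *)
Lemma rep_transform A B x :
  rep A B x = (rep (A :|: B) (A :&: B) x + rep (A :\: B) (B :\: A) x)%N.
Proof.
have -> : rep (A :|: B) (A :&: B) x = (rep (A :&: B) A x + rep (A :&: B) (B :\: A) x)%N.
  by rewrite rep_sym (rep_setID _ _ A) setUK setDUl setDv set0U.
have -> : rep (A :\: B) (B :\: A) x = rep (B :\: A) (A :\: B) x by apply: rep_sym.
rewrite (rep_setID A B A) [B :&: A]setIC [rep A (B :\: A) x]rep_sym (rep_setID _ A B).
by rewrite [rep A _ x]rep_sym [rep (B :\: A) (A :&: B) x]rep_sym addnA.
Qed.

Lemma rep_subset A A' B x : A \subset A' -> (rep A B x <= rep A' B x)%N.
Proof.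
move=> sAA'; apply: leq_sum => y _.
by case: (boolP (_ \in A)) => // /(subsetP sAA') ->.
Qed.

End RepCount.

Lemma card_Zp_type p : (1 < p)%N -> #|'Z_p| = p.
Proof. by move=> p_gt1; rewrite card_ord Zp_cast. Qed.

Lemma Zp_prime_unit p (d : 'Z_p) : prime p -> d != 0 -> d \is a GRing.unit.
Proof.
move=> p_pr d_neq0; have p_gt1 := prime_gt1 p_pr.
rewrite -(natr_Zp d) unitZpE // prime_coprime // gtnNdvd //.
  by rewrite lt0n.
by have := ltn_ord d; rewrite [X in (_ < X)%N]Zp_cast.
Qed.

(** A set stable under adding [d] contains a translate of all multiples of [d], hence everything, as
    [d] is invertible modulo [p]. *)
Lemma exists_addr_notin p (A : {set 'Z_p}) (d : 'Z_p) : prime p ->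
  A != set0 -> A != setT -> d != 0 -> exists2 a, a \in A & a + d \notin A.
Proof.
move=> p_pr /set0Pn[a0 Aa0] A_neqT d_neq0.
apply/exists_inP; apply: contraR A_neqT.
rewrite negb_exists_in => /forall_inP A_stable.
have A_iter k : a0 + d *+ k \in A.
  elim: k => [|k IHk]; first by rewrite addr0.
  by rewrite mulrSr addrA; have := A_stable _ IHk; rewrite negbK.
apply/eqP/setP => y; rewrite inE.
have := A_iter (nat_of_ord ((y - a0) / d)).
by rewrite -mulr_natl natr_Zp divrK ?Zp_prime_unit // addrC subrK.
Qed.

Lemma exists_translate_meet p (A B : {set 'Z_p}) : prime p ->
  A != set0 -> A != setT -> (1 < #|B|)%N ->
  exists e, (0 < #|A :&: translate B e| < #|B|)%N.
Proof.
move=> p_pr A_neq0 A_neqT /card_gt1P[y1 [y2 [By1 By2 neq_y]]].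
have [|a Aa nAa] := @exists_addr_notin p A (y2 - y1) p_pr A_neq0 A_neqT.
  by rewrite subr_eq0 eq_sym.
(* This translation sends [y1] to [a], inside [A], and [y2] to [a + (y2 - y1)], outside it. *)
exists (a - y1); apply/andP; split.
  apply/card_gt0P; exists a; rewrite inE Aa; apply/imsetP; exists y1 => //.
  by rewrite addrC subrK.
rewrite -[ltnRHS](card_imset _ (@addIr _ (a - y1))); apply: proper_card.
rewrite properE subsetIr; apply: contra nAa => /subsetP/(_ (y2 + (a - y1))).
rewrite (imset_f (+%R^~ (a - y1))) ?By2 // inE => /(_ isT)/andP[].
by rewrite addrCA addrA addrAC.
Qed.

Lemma leq_add_minn (c d n t : nat) : (c <= n)%N -> (n <= t)%N ->
  (c + minn (t - n) d <= minn t (c + d))%N.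
Proof. by lia. Qed.

(** Induction on [#|B|]: a translate of [B] is made to meet [A] without lying inside it, so that
    both [A :&: B] and [B :\: A] are smaller than [B]. *)
Theorem pollard p (A B : {set 'Z_p}) t : prime p ->
  (t <= #|A|)%N -> (t <= #|B|)%N -> (#|A| + #|B| <= p + t)%N ->
  (t * (#|A| + #|B| - t) <= \sum_x minn t (rep A B x))%N.
Proof.
move=> p_pr; have [m] := ubnP #|B|; elim: m A B t => // m IHm A B t.
rewrite ltnS => leBm le_tA le_tB le_ABt.
have [->//|t_gt0] := posnP t.
have [eq_tB|lt_tB] := eqVneq t #|B|.
  under eq_bigr => x _ do rewrite eq_tB (minn_idPr (rep_le A B x)).
  by rewrite sum_rep eq_tB addnK mulnC.
have A_neq0 : A != set0 by rewrite -card_gt0; lia.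
have A_neqT : A != setT.
  by apply/eqP => A_T; move: le_ABt; rewrite A_T cardsT card_Zp_type ?prime_gt1 //; lia.
have [|e] := exists_translate_meet p_pr A_neq0 A_neqT (B := B); first lia.
pose B1 := translate B e; rewrite -/B1.
have cardB1 : #|B1| = #|B| by rewrite card_imset //; apply: addIr.
have -> : (\sum_x minn t (rep A B x) = \sum_x minn t (rep A B1 x))%N.
  by rewrite [RHS](reindex_inj (addIr e)); apply: eq_bigr => x _; rewrite rep_shift addrK.
rewrite -cardB1 in leBm le_tB lt_tB le_ABt *; move: B1 leBm le_tB lt_tB le_ABt {cardB1}.
move=> {}B leBm le_tB lt_tB le_ABt /andP[C_gt0 C_lt].
have cardUI := cardsUI A B.
have cardDA := cardsID B A; have cardDB := cardsID A B; rewrite setIC in cardDB.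
(* When the transform makes A :&: B smaller than t, its pair already saturates the
   threshold #|A :&: B|, and the remaining t - #|A :&: B| comes from the differences. *)
have [le_tC|lt_Ct] := leqP t #|A :&: B|.
  have := IHm (A :|: B) (A :&: B) t; rewrite cardUI => IH.
  apply: leq_trans (IH _ _ _ _) _; try lia.
  apply: leq_sum => x _; rewrite (rep_transform A B x).
  by rewrite leq_min geq_minl (leq_trans (geq_minr _ _)) ?leq_addr.
have IH := IHm (A :\: B) (B :\: A) (t - #|A :&: B|)%N.
apply: (@leq_trans (\sum_x (rep (A :|: B) (A :&: B) x +
    minn (t - #|A :&: B|) (rep (A :\: B) (B :\: A) x))))%N; last first.
  apply: leq_sum => x _; rewrite (rep_transform A B).
  by apply: leq_add_minn (ltnW lt_Ct); apply: rep_le.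
rewrite big_split sum_rep /=.
apply: leq_trans (leq_add (leqnn _) (IH _ _ _ _)); try lia.
(* With c the size of [A :&: B], the two bounds add up exactly to the target, because c^2 - (t -
   c)^2 = t (2c - t). *)
have -> : #|A :|: B| = (#|A :\: B| + #|B :\: A| + #|A :&: B|)%N by lia.
rewrite -{1}cardDA -{1}cardDB.
move: #|A :\: B| #|B :\: A| #|A :&: B| cardDA cardDB lt_Ct le_tA lt_tB => a b c; nia.
Qed.

(** * Intervals *)

Section Intervals.
Variable p : nat.
Implicit Types (a b x z : 'Z_p) (j k l m s t : nat).

(* The cardinal of {x | s <= rep A B x} for intervals A and B of sizes k and l. *)
Definition level_card k l s : nat :=
  if (s + p <= k + l)%N then p
  else if (s <= k)%N && (s <= l)%N then ((k + l).+1 - s.*2)%N else 0%N.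

Lemma level_card_le k l s : (0 < s)%N -> (level_card k l s <= p)%N.
Proof. by rewrite /level_card; case: ifP => // ?; case: ifP => // ?; lia. Qed.

(** This closed form is Pollard's bound, so intervals attain it. The two branches agree when
    [t + p = k + l], where the levels stop being full. *)
Lemma sum_level_card k l t : (k <= p)%N -> (l <= p)%N -> (t <= k)%N -> (t <= l)%N ->
  (\sum_(s < t) level_card k l s.+1 =
   if t + p <= k + l then t * p else t * (k + l - t))%N.
Proof.
move=> le_kp le_lp; elim: t => [|t IHt] lt_tk lt_tl; first by rewrite big_ord0 !mul0n if_same.
rewrite big_ord_recr /= IHt ?(ltnW lt_tk) ?(ltnW lt_tl) // /level_card lt_tk lt_tl /=.
have [le_t|lt_t] := leqP (t.+1 + p) (k + l); first by rewrite ifT; lia.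
case: leqP => [le_t|lt_t'].
  have -> : (k + l = t + p)%N by lia.
  by nia.
by nia.
Qed.

(* This is {0}, {0, 1}, {-1, 0, 1}, {-1, 0, 1, 2}, ... for m = 1, 2, 3, 4, ... *)
Definition centred_itv m : {set 'Z_p} := Zp_itv (- ((m - 1)./2)%:R) m.

Lemma centred_itv_subset m m' : (m <= m')%N -> centred_itv m \subset centred_itv m'.
Proof.
move=> le_m; apply/subsetP => _ /imsetP[i _ ->].
have lt_im := ltn_ord i.
have lt_i : (i + ((m' - 1)./2 - (m - 1)./2) < m')%N by lia.
apply/imsetP; exists (Ordinal lt_i) => //=.
rewrite natrD natrB; last by lia.
by ring.
Qed.

Lemma sumset_rep (A B : {set 'Z_p}) : sumset A B = [set x | (0 < rep A B x)%N].
Proof.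
apply/setP => x; rewrite inE lt0n sum_nat_eq0 negb_forall_in; apply/imset2P/exists_inP.
  by move=> [u v Au Bv ->]; exists v => //; rewrite addrK Au.
move=> [v Bv]; rewrite eqb0 negbK => Auv.
by exists (x - v) v; rewrite ?subrK.
Qed.

Hypothesis p_gt1 : (1 < p)%N.

Lemma ltn_Zp z : (z < p)%N.
Proof. by have := ltn_ord z; rewrite [X in (_ < X)%N -> _]Zp_cast. Qed.

Lemma Zp_nat_sub z j : (j < p)%N ->
  (z - j%:R : 'Z_p) = (if j <= z then z - j else p + z - j)%N :> nat.
Proof.
move=> lt_jp; have lt_zp := ltn_Zp z; rewrite -{1}(natr_Zp z).
case: leqP => [le_jz|lt_zj].
  by rewrite -natrB // val_Zp_nat // modn_small //; lia.
have -> : (z%:R - j%:R : 'Z_p) = (p + z - j)%:R.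
  by rewrite natrB ?natrD ?pchar_Zp ?add0r //; lia.
by rewrite val_Zp_nat // modn_small //; lia.
Qed.

Lemma mem_Zp_itv a k x : (k <= p)%N -> (x \in Zp_itv a k) = ((x - a)%R < k)%N.
Proof.
move=> le_kp; apply/imsetP/idP => [[i _ ->]|lt_xk].
  rewrite [a + _]addrC addrK val_Zp_nat // modn_small //.
  exact: leq_trans (ltn_ord i) le_kp.
exists (Ordinal lt_xk) => //; rewrite -{1}[x](subrK a) addrC; congr (_ + _).
exact/esym/natr_Zp.
Qed.

Lemma Zp_itv_inj a k : (k <= p)%N -> injective (fun i : 'I_k => a + (i : nat)%:R).
Proof.
move=> le_kp i j /addrI/(congr1 (@nat_of_ord _)); rewrite !val_Zp_nat // => eq_ij.
by apply: val_inj; rewrite /= -(modn_small (leq_trans (ltn_ord i) le_kp)) eq_ij modn_small //;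
   apply: leq_trans (ltn_ord j) le_kp.
Qed.

Lemma card_Zp_itv a k : (k <= p)%N -> #|Zp_itv a k| = k.
Proof. by move=> le_kp; rewrite card_imset ?card_ord //; apply: Zp_itv_inj. Qed.

Lemma Zp_itv_full a : Zp_itv a p = setT.
Proof. by apply/setP => x; rewrite mem_Zp_itv // inE ltn_Zp. Qed.

(** The left end of a proper interval is its only point whose predecessor lies outside. *)
Lemma Zp_itv_uniq a b k l : (0 < k < p)%N -> (0 < l < p)%N ->
  Zp_itv a k = Zp_itv b l -> a = b /\ k = l.
Proof.
move=> /andP[k_gt0 lt_kp] /andP[l_gt0 lt_lp] eq_itv.
have eq_kl : k = l.
  by have := congr1 (fun S : {set 'Z_p} => #|S|) eq_itv; rewrite !card_Zp_itv // ltnW.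
split=> //; move: eq_itv; rewrite -{l}eq_kl in l_gt0 lt_lp * => /setP eq_itv.
have := eq_itv a; have := eq_itv (a - 1).
rewrite !mem_Zp_itv ?(ltnW lt_kp) // subrr k_gt0 => + /esym.
have -> : a - 1 - a = 0 - 1%:R :> 'Z_p by rewrite addrAC subrr.
have -> : a - 1 - b = (a - b) - 1%:R :> 'Z_p by rewrite addrAC.
have -> : nat_of_ord (0 - 1%:R : 'Z_p) = (p - 1)%N by rewrite Zp_nat_sub //= addn0.
rewrite Zp_nat_sub //.
case: (leqP 1 (nat_of_ord (a - b))) => [_|ab_lt1 _ _].
  by move: (nat_of_ord (a - b)) => d; lia.
apply/eqP; rewrite -subr_eq0; apply/eqP/val_inj => /=.
by move: ab_lt1; rewrite ltnS leqn0 => /eqP.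
Qed.

(** This counts the [j < l] for which [z - j] modulo [p] is below [k]: the first term is for
    [j <= z], the second for [j > z], where the difference wraps around. *)
Lemma rep_Zp_itv a b k l x : (k <= p)%N -> (l <= p)%N ->
  let z : nat := x - (a + b) in
  rep (Zp_itv a k) (Zp_itv b l) x =
  ((minn l z.+1 - (z.+1 - k)) + (l - (p + z.+1 - k)))%N.
Proof.
move=> le_kp le_lp z; have lt_zp : (z < p)%N by apply: ltn_Zp.
rewrite /rep big_imset; last by move=> i j _ _; apply: Zp_itv_inj.
rewrite (eq_bigr (fun j : 'I_l => nat_of_bool ((if j <= z then z - j else p + z - j) < k)%N))
  => [|j _]; last first.
  rewrite mem_Zp_itv // /z -Zp_nat_sub; last exact: leq_trans (ltn_ord j) le_lp.
  by have -> : x - (b + j%:R) - a = x - (a + b) - j%:R by ring.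
move: z lt_zp => {x a b}z lt_zp.
elim: l le_lp => [|l IHl] lt_lp; first by rewrite big_ord0; lia.
by rewrite big_ord_recr /= IHl ?(ltnW lt_lp) //; case: (leqP l z); lia.
Qed.

Lemma rep_Zp_itv_level a b k l s : (0 < s)%N -> (k <= p)%N -> (l <= p)%N ->
  [set x | (s <= rep (Zp_itv a k) (Zp_itv b l) x)%N] =
  Zp_itv (a + b + (s - 1)%:R) (level_card k l s).
Proof.
move=> s_gt0 le_kp le_lp; apply/setP => x; rewrite inE rep_Zp_itv // mem_Zp_itv ?level_card_le //.
pose z := x - (a + b); rewrite -/z; have lt_zp := ltn_Zp z.
rewrite opprD addrA -/z /level_card.
case: ifP => [le_s|/negbT]; first by rewrite ltn_Zp; lia.
rewrite -ltnNge => lt_s.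
case: ifP => [/andP[le_sk le_sl]|gt_s]; last by lia.
by rewrite Zp_nat_sub; [case: (leqP (s - 1) z)|]; lia.
Qed.

(** The equation puts the left end of the sumset where [centred_itv (k + l - 1)] starts; each
    further level below saturation loses one point at both ends and so keeps the centre. *)
Lemma rep_level_centred a b k l s : (0 < s)%N -> (k <= p)%N -> (l <= p)%N ->
  (0 < k)%N -> (0 < l)%N -> a + b + ((k + l)./2 - 1)%:R = 0 ->
  [set x | (s <= rep (Zp_itv a k) (Zp_itv b l) x)%N] = centred_itv (level_card k l s).
Proof.
move=> s_gt0 le_kp le_lp k_gt0 l_gt0 /eqP; rewrite addr_eq0 => /eqP ab_eq.
rewrite rep_Zp_itv_level // /centred_itv.
have := level_card_le k l s_gt0; rewrite /level_card.
case: ifP => [_ _|_]; first by rewrite !Zp_itv_full.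
case: ifP => [/andP[le_sk le_sl] _|_ _]; last by apply/setP => x; rewrite !mem_Zp_itv.
congr Zp_itv; rewrite ab_eq.
have -> : ((k + l)./2 - 1 = ((k + l).+1 - s.*2 - 1)./2 + (s - 1))%N by lia.
by rewrite natrD; ring.
Qed.

(* The hypothesis says that an interval of size q - 1 starting at n is centred at
   0 or 1/2. *)
Lemma half_pt_eq n q : (1 < q)%N ->
  half_pt p (odd q) = half_pt p (2 * n + (q - 2)) -> (n%:R + (q./2 - 1)%:R = 0 :> 'Z_p).
Proof.
move=> q_gt1 /(congr1 (@nat_of_ord _)); rewrite !val_Zp_nat; try lia.
have -> : (2 * n + (q - 2) = 2 * (n + (q./2 - 1)) + odd q)%N by lia.
move/eqP; rewrite -[X in X == _ %[mod _]]add0n eqn_modDr mod0n eq_sym -/(dvdn _ _).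
rewrite dvdn_pmul2l // => /dvdnP[c eq_c].
by rewrite -natrD eq_c natrM pchar_Zp // mulr0.
Qed.

(** All cases of [sum_centred] are reduced to the single equation on left ends that
    [rep_level_centred] takes. *)
Lemma sum_centred_itv (A B : {set 'Z_p}) : is_itv A -> is_itv B -> sum_centred A B ->
  exists a b, [/\ A = Zp_itv a #|A|, B = Zp_itv b #|B|
    & a + b + ((#|A| + #|B|)./2 - 1)%:R = 0].
Proof.
move=> [a [k [/andP[k_gt0 le_kp] eqA]]] [b [l [/andP[l_gt0 le_lp] eqB]]].
have cardA : #|A| = k by rewrite eqA card_Zp_itv.
have cardB : #|B| = l by rewrite eqB card_Zp_itv.
rewrite /sum_centred !cardA !cardB.
(* The whole group is an interval starting at any point. *)
have [eq_kp _|neq_kp] := eqVneq k p.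
  exists (- b - ((k + l)./2 - 1)%:R), b; split=> //; last by ring.
  by rewrite eqA eq_kp !Zp_itv_full.
have [eq_lp _|neq_lp] := eqVneq l p.
  exists a, (- a - ((k + l)./2 - 1)%:R); split=> //; last by ring.
  by rewrite eqB eq_lp !Zp_itv_full.
have lt_kp : (k < p)%N by rewrite ltn_neqAle neq_kp.
have lt_lp : (l < p)%N by rewrite ltn_neqAle neq_lp.
have neqT k' (a' : 'Z_p) : (k' < p)%N -> Zp_itv a' k' != setT.
  move=> lt_k'; apply: contraTneq lt_k' => eqT.
  case: (leqP k' p) => [le_k'|]; last by lia.
  by rewrite -(card_Zp_itv a' le_k') eqT cardsT card_Zp_type // ltnn.
case: ifPn => [sum_neqT|_].
  (* The sumset is the level [s = 1] of [rep], an interval starting at [a + b]; uniqueness of left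
     ends then reads off its centre. *)
  rewrite sumset_rep eqA eqB rep_Zp_itv_level // addr0 in sum_neqT *.
  have := sum_neqT; rewrite /level_card k_gt0 l_gt0.
  case: ifP => [|/negbT]; first by rewrite Zp_itv_full eqxx.
  rewrite -ltnNge /= => lt_klp sum_neqT' [eqT|]; first by rewrite eqT eqxx in sum_neqT'.
  move=> [c [m [m_itv]]].
  have itv_kl : (0 < (k + l).+1 - 2 < p)%N by lia.
  move=> /(Zp_itv_uniq itv_kl m_itv)[<- <-].
  have -> : ((k + l).+1 - 1.*2 - 1 = k + l - 2)%N by lia.
  move=> /half_pt_eq.
  rewrite natr_Zp => eq0; exists a, b; split=> //; apply: eq0; lia.
move=> [cA [cB []]].
case=> [eqT|[a1 [k1 [k1_itv eqA1 ->]]]]; first by move: (neqT k a lt_kp); rewrite -eqA eqT eqxx.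
case=> [eqT|[b1 [l1 [l1_itv eqB1 ->]]]]; first by move: (neqT l b lt_lp); rewrite -eqB eqT eqxx.
have eq_k1 : k1 = k by rewrite -cardA eqA1 card_Zp_itv; lia.
have eq_l1 : l1 = l by rewrite -cardB eqB1 card_Zp_itv; lia.
rewrite /half_pt -natrD -!/(half_pt _ _) => /esym eq_c.
exists a1, b1; rewrite eqA1 eqB1 eq_k1 eq_l1; split=> //.
rewrite -[a1]natr_Zp -[b1]natr_Zp -natrD.
apply: half_pt_eq; first by lia.
by rewrite eq_c; congr half_pt; lia.
Qed.

End Intervals.

(** * Comparison of arbitrary sets with intervals *)

Lemma sum_minn_rep_lower p (A B : {set 'Z_p}) t : prime p -> (t <= #|A|)%N -> (t <= #|B|)%N ->
  ((if t + p <= #|A| + #|B| then t * p else t * (#|A| + #|B| - t)) <=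
   \sum_x minn t (rep A B x))%N.
Proof.
move=> p_pr le_tA le_tB.
case: (leqP (t + p) (#|A| + #|B|)) => [le_t|/ltnW]; last by rewrite [(t + p)%N]addnC; apply: pollard.
(* Shrink A until #|A| + #|B| - t = p. *)
have le_Bp : (#|B| <= p)%N by rewrite -[leqRHS]card_Zp_type ?max_card ?prime_gt1.
have : (p + t - #|B| <= #|A|)%N by lia.
move=> /card_geqP[s [s_uniq s_size sA]].
pose A0 : {set 'Z_p} := [set x in s].
have cardA0 : #|A0| = (p + t - #|B|)%N by rewrite cardsE (card_uniqP s_uniq).
have sA0 : A0 \subset A by apply/subsetP => x; rewrite inE; apply: sA.
apply: leq_trans (_ : \sum_x minn t (rep A0 B x) <= _)%N; last first.
  apply: leq_sum => x _; rewrite leq_min geq_minl (leq_trans (geq_minr _ _)) //.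
  exact: rep_subset.
apply: leq_trans (pollard p_pr _ _ _); rewrite ?cardA0 //; try lia.
by rewrite subnK ?addnK //; lia.
Qed.

Lemma sum_minn_rep_itv_le p (A B A' B' : {set 'Z_p}) t : prime p ->
  A != set0 -> B != set0 -> is_itv A' -> is_itv B' -> #|A'| = #|A| -> #|B'| = #|B| ->
  sum_centred A' B' -> (t <= #|B|)%N ->
  (\sum_x minn t (rep A' B' x) <= \sum_x minn t (rep A B x))%N.
Proof.
move=> p_pr A_neq0 B_neq0 itvA itvB cardA cardB centred le_tB.
have p_gt1 := prime_gt1 p_pr.
(* For [t > #|A|] the minimum never cuts, and both sums equal [#|A| * #|B|]. *)
have [lt_At|le_tA] := ltnP #|A| t.
  have min_rep (C D : {set 'Z_p}) x : #|C| = #|A| -> minn t (rep C D x) = rep C D x.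
    move=> cardC; apply/minn_idPr; rewrite rep_sym; apply: leq_trans (rep_le _ _ _) _.
    by rewrite cardC ltnW.
  under eq_bigr do rewrite min_rep //.
  under [leqRHS]eq_bigr do rewrite min_rep //.
  by rewrite !sum_rep cardA cardB.
apply: leq_trans (sum_minn_rep_lower p_pr le_tA le_tB).
have card_le (C : {set 'Z_p}) : (#|C| <= p)%N by rewrite -[leqRHS](card_Zp_type p_gt1) max_card.
have [a [b [eqA eqB ab0]]] := sum_centred_itv p_gt1 itvA itvB centred.
rewrite sum_minn_card -sum_level_card //; apply: leq_sum => s _.
rewrite eqA eqB rep_level_centred ?cardA ?cardB ?card_gt0 //; last by rewrite -cardA -cardB.
by rewrite card_Zp_itv // level_card_le.
Qed.

Lemma sublevel_setC (T : finType) (f : T -> nat) t :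
  [set x | (f x <= t)%N] = ~: [set x | (t < f x)%N].
Proof. by apply/setP => x; rewrite !inE -leqNgt. Qed.

Lemma sum_card_sublevel (T : finType) (f : T -> nat) k :
  (\sum_(t < k) #|[set x | (f x <= t)%N]| = k * #|T| - \sum_x minn k (f x))%N.
Proof.
have <- : (\sum_(t < k) (#|[set x | t < f x]| + #|[set x | f x <= t]|) = k * #|T|)%N.
  rewrite -[X in (X * _)%N]card_ord -sum_nat_const; apply: eq_bigr => t _.
  by rewrite sublevel_setC cardsC.
by rewrite big_split sum_minn_card addKn.
Qed.

Lemma sum_prod_missed_le (I : finType) p (A B A' B' : I -> {set 'Z_p}) : prime p ->
  (forall i, A i != set0) -> (forall i, B i != set0) ->
  (forall i, is_itv (A' i)) -> (forall i, is_itv (B' i)) ->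
  (forall i, #|A' i| = #|A i|) -> (forall i, #|B' i| = #|B i|) ->
  (forall i, sum_centred (A' i) (B' i)) ->
  (\sum_x \prod_i (#|B i| - rep (A i) (B i) x) <=
   \sum_x \prod_i (#|B i| - rep (A' i) (B' i) x))%N.
Proof.
move=> p_pr A_neq0 B_neq0 itvA itvB cardA cardB centred.
have p_gt1 := prime_gt1 p_pr.
pose l := index_enum I; pose S : {set 'Z_p} := setT.
have sum_setT F : (\sum_x F x = \sum_(x in S) F x)%N.
  by apply: eq_bigl => x; rewrite inE.
rewrite !sum_setT; apply: leq_trans (sum_prod_le_layers _ _ l S) _.
(* The chain is that of the complements of centred intervals; [m = 0] gives the full set. *)
rewrite (@sum_prod_eq_layers _ _ _ _ (fun X => exists m, X = ~: centred_itv p m)).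
- apply: layers_le => i c.
  apply: (@sum_min_le _ (fun t => #|[set x | (rep (A i) (B i) x <= t)%N]|)
    (fun t => #|[set x | (rep (A' i) (B' i) x <= t)%N]|)) => [s t le_st|j le_j].
    by apply/subset_leq_card/subsetP => x; rewrite !inE => /leq_trans->.
  rewrite !sum_card_sublevel leq_sub2l //.
  exact: sum_minn_rep_itv_le.
- move=> _ _ [m ->] [m' ->]; rewrite !setCS.
  by case: (leqP m m') => [|/ltnW] le_m; [right|left]; apply: centred_itv_subset.
- move=> i t; have [a [b []]] := sum_centred_itv p_gt1 (itvA i) (itvB i) (centred i).
  have card_le (C : {set 'Z_p}) : (#|C| <= p)%N by rewrite -[leqRHS](card_Zp_type p_gt1) max_card.
  rewrite cardA cardB => -> -> ab0; exists (level_card p #|A i| #|B i| t.+1).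
  by rewrite sublevel_setC rep_level_centred ?card_le ?card_gt0.
- by exists 0; apply/setP => x; rewrite !inE mem_Zp_itv.
Qed.

(** * The expected size of the union *)

Lemma sum_unif (T : finType) (B : {set T}) (P : pred T) :
  \sum_y unif B y * (P y)%:R = (\sum_(y in B) P y)%:R / #|B|%:R.
Proof.
rewrite natr_sum mulr_suml [RHS]big_mkcond; apply: eq_bigr => y _; rewrite /unif.
by case: ifP => _; rewrite ?mul0r // mulrC.
Qed.

Lemma sum_notin_rep p (A B : {set 'Z_p}) x :
  (\sum_(y in B) (x - y \notin A)%R = #|B| - rep A B x)%N.
Proof.
rewrite /rep -sum1_card -sumnB; last by move=> y _; apply: leq_b1.
by apply: eq_bigr => y _; case: (_ \in _).
Qed.

Lemma mem_translate p (A : {set 'Z_p}) b x : (x \in translate A b) = (x - b \in A).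
Proof.
by apply/imsetP/idP => [[y Ay ->]|Ax]; [rewrite addrK | exists (x - b); rewrite ?subrK].
Qed.

Lemma card_bigcup_translate n p (A : 'I_n -> {set 'Z_p}) (b : 'I_n -> 'Z_p) :
  #|\bigcup_i translate (A i) (b i)|%:R =
    #|'Z_p|%:R - \sum_x \prod_i (x - b i \notin A i)%:R :> rat.
Proof.
rewrite -sum1_card big_mkcond /= natr_sum -[X in X%:R - _]sum1_card natr_sum -sumrB.
apply: eq_bigr => x _; case: bigcupP => [[i _]|no_i].
  by rewrite mem_translate => Ax; rewrite (bigD1 i) //= Ax mul0r subr0.
rewrite big1 ?subrr // => i _; case: (boolP (_ \in _)) => //= Ax.
by case: no_i; exists i; rewrite ?mem_translate.
Qed.

Lemma expected_unionE n p (A B : 'I_n -> {set 'Z_p}) : (forall i, B i != set0) ->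
  expected_union A B = #|'Z_p|%:R -
    (\sum_x \prod_i (#|B i| - rep (A i) (B i) x))%N%:R / \prod_i #|B i|%:R.
Proof.
move=> B_neq0.
have cardB i : #|B i|%:R != 0 :> rat by rewrite Num.Theory.pnatr_eq0 cards_eq0.
rewrite /expected_union /expect_unif.
have sum1 : \sum_(b : {ffun 'I_n -> 'Z_p}) \prod_i unif (B i) (b i) = 1.
  rewrite -(bigA_distr_bigA (fun i y => unif (B i) y)) big1 // => i _.
  transitivity (\sum_y unif (B i) y * (predT y)%:R); first by apply: eq_bigr => y _; rewrite mulr1.
  by rewrite sum_unif sum1_card divff.
under [LHS]eq_bigr => b _ do rewrite card_bigcup_translate mulrBr mulr_sumr.
rewrite sumrB -mulr_suml sum1 mul1r exchange_big natr_sum mulr_suml; congr (_ - _).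
apply: eq_bigr => x _ /=.
under eq_bigr do rewrite -big_split.
(* Independence: the sum over all choice functions of a product becomes a product of one-variable
   sums. *)
rewrite -(bigA_distr_bigA (fun i y => unif (B i) y * (x - y \notin A i)%:R)) /=.
rewrite natr_prod -prodf_div; apply: eq_bigr => i _.
by rewrite (sum_unif _ (fun y => x - y \notin A i)) sum_notin_rep.
Qed.

Theorem theorem1p5 (n p : nat) (hn : (0 < n)%N) (hp : prime p)
    (A B A' B' : 'I_n -> {set 'Z_p})
    (hA : forall i : 'I_n, A i != set0)
    (hB : forall i : 'I_n, B i != set0)
    (hA' : forall i : 'I_n, is_itv (A' i))
    (hB' : forall i : 'I_n, is_itv (B' i))
    (hcardA : forall i : 'I_n, #|A' i| = #|A i|)
    (hcardB : forall i : 'I_n, #|B' i| = #|B i|)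
    (hcentre : forall i : 'I_n, sum_centred (A' i) (B' i)) :
  expected_union A' B' <= expected_union A B.
Proof.
have hB'0 i : B' i != set0 by rewrite -card_gt0 hcardB card_gt0.
rewrite !expected_unionE //; under eq_bigr do under eq_bigr do rewrite hcardB.
under [X in _ / X]eq_bigr do rewrite hcardB.
rewrite Num.Theory.lerD2l Num.Theory.lerN2 Num.Theory.ler_wpM2r //.
  by rewrite Num.Theory.invr_ge0 Num.Theory.prodr_ge0.
by rewrite Num.Theory.ler_nat; apply: sum_prod_missed_le.
Qed.
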